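(* Let $\mathbb K$ be an algebraically closed field of characteristic $2$ and let $\mathfrak g=\mathfrak{oo}^{(1)}_{I\Pi}(1|4)$. Then $H^1(\mathfrak g;\mathfrak g)=0$ and $H^2(\mathfrak g)=0$.
   Context: $\mathfrak{oo}_{I\Pi}(1|4)$ is the Lie superalgebra of supermatrices $X\in\mathfrak{gl}(1|4)$ preserving the even symmetric bilinear form with Gram matrix $B=\operatorname{diag}(1_1,\Pi_4)$, $\Pi_4=\begin{pmatrix}0&1_2\\1_2&0\end{pmatrix}$, i.e., $X^{\rm t}B+BX=0$, with the squaring of odd elements given by the matrix square; $\mathfrak{oo}^{(1)}_{I\Pi}(1|4)$ is its derived algebra (the span of all brackets and of all squares of odd elements). A Lie superalgebra in characteristic $2$ has a squaring $x\mapsto x^2$, $\mathfrak g_{\bar1}\to\mathfrak g_{\bar0}$, with $(ax)^2=a^2x^2$, $[x,y]=(x+y)^2-x^2-y^2$ on $\mathfrak g_{\bar1}$, $[x^2,y]=[x,[x,y]]$. $H^1(\mathfrak g;\mathfrak g)$ is the superspace of all derivations (also satisfying $D(x^2)=[Dx,x]$ for odd $x$) modulo inner ones. $H^2(\mathfrak g)$ (trivial coefficients, both parities): a 2-cocycle is a pair $(c,q)$, $c$ an alternating bilinear form on $\mathfrak g$, $q$ a quadratic form on $\mathfrak g_{\bar1}$ with polar form $c|_{\mathfrak g_{\bar1}}$, such that $c([x,y],z)+c([y,z],x)+c([z,x],y)=0$ and $c(x^2,y)=c(x,[x,y])$ for odd $x$ and all $y$; coboundaries are $c(x,y)=f([x,y])$,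 $q(x)=f(x^2)$ with $f$ linear. *)

(* Defs.v *)
From HB Require Import structures.
From mathcomp Require Import all_boot all_order all_algebra.
From mathcomp Require Import ring.

Set Implicit Arguments.
Unset Strict Implicit.
Unset Printing Implicit Defensive.

Import GRing.Theory.
Local Open Scope ring_scope.

(* In characteristic 2 all signs disappear.  That [x, x] = 0 for every x, odd *)
(* x included, follows from [x, y] = (x + y)^2 - x^2 - y^2 on the odd part;   *)
(* the remaining instances of ls_brxx and ls_jacobi are those of a Lie        *)
(* algebra ls_even, its module ls_odd, and the polarized ls_sq_br.  The value *)
(* of ls_sq outside ls_odd is irrelevant.                                     *)
Record lieSuperalg2 (K : fieldType) := LieSuperalg2 {
  ls_char2 : 2%N \in [pchar K];
  ls_sort :> vectType K;
  ls_even : {vspace ls_sort};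
  ls_odd : {vspace ls_sort};
  ls_full : (ls_even + ls_odd = fullv)%VS;
  ls_direct : (ls_even :&: ls_odd = 0)%VS;
  ls_br : {bilinear ls_sort -> ls_sort -> ls_sort};
  ls_br00 : forall x y, x \in ls_even -> y \in ls_even -> ls_br x y \in ls_even;
  ls_br01 : forall x y, x \in ls_even -> y \in ls_odd -> ls_br x y \in ls_odd;
  ls_br11 : forall x y, x \in ls_odd -> y \in ls_odd -> ls_br x y \in ls_even;
  ls_brxx : forall x, ls_br x x = 0;
  ls_jacobi : forall x y z,
    ls_br x (ls_br y z) + ls_br y (ls_br z x) + ls_br z (ls_br x y) = 0;
  ls_sq : ls_sort -> ls_sort;
  ls_sq_even : forall x, x \in ls_odd -> ls_sq x \in ls_even;
  ls_sqZ : forall a x, x \in ls_odd -> ls_sq (a *: x) = a ^+ 2 *: ls_sq x;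
  ls_sqD : forall x y, x \in ls_odd -> y \in ls_odd ->
    ls_br x y = ls_sq (x + y) - ls_sq x - ls_sq y;
  ls_sq_br : forall x y, x \in ls_odd -> ls_br (ls_sq x) y = ls_br x (ls_br x y)
}.

Arguments ls_even {K} l.
Arguments ls_odd {K} l.
Arguments ls_br {K l}.
Arguments ls_sq {K l}.

Notation "\br[ x , y ]" := (ls_br x y)
  (at level 0, x, y at level 99, format "\br[ x ,  y ]") : ring_scope.

Section Cohomology.
Variables (K : fieldType) (L : lieSuperalg2 K).

(* No parity is imposed on D: conditions hold for D exactly when they hold    *)
(* for its even and its odd component.                                        *)
Definition derivation (D : 'End(L)) : Prop :=
  (forall x y : L, D \br[x, y] = \br[D x, y] + \br[x, D y]) /\
  (forall x : L, x \in ls_odd L -> D (ls_sq x) = \br[D x, x]).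

Definition inner_derivation (D : 'End(L)) : Prop :=
  exists y : L, forall x : L, D x = \br[y, x].

(* The quotient derivations / inner derivations is zero. *)
Definition H1_adjoint_eq0 : Prop :=
  forall D : 'End(L), derivation D -> inner_derivation D.

(* q is a quadratic form on the odd part, so only q restricted to ls_odd is   *)
(* ever constrained.                                                          *)
Definition quadratic_on_odd (c : {biscalar L}) (q : L -> K) : Prop :=
  (forall a x, x \in ls_odd L -> q (a *: x) = a ^+ 2 * q x) /\
  (forall x y, x \in ls_odd L -> y \in ls_odd L ->
     q (x + y) - q x - q y = c x y).

Definition cocycle2 (c : {biscalar L}) (q : L -> K) : Prop :=
  [/\ forall x : L, c x x = 0,
      quadratic_on_odd c q,
      forall x y z : L, c \br[x, y] z + c \br[y, z] x + c \br[z, x] y = 0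
    & forall x y : L, x \in ls_odd L -> c (ls_sq x) y = c x \br[x, y]].

Definition coboundary2 (c : {biscalar L}) (q : L -> K) : Prop :=
  exists f : {scalar L},
    (forall x y : L, c x y = f \br[x, y]) /\
    (forall x : L, x \in ls_odd L -> q x = f (ls_sq x)).

(* The quotient cocycles / coboundaries is zero. *)
Definition H2_trivial_eq0 : Prop :=
  forall (c : {biscalar L}) (q : L -> K), cocycle2 c q -> coboundary2 c q.

Lemma ls_oppr (x : L) : - x = x.
Proof.
by rewrite -scaleN1r -[-1]/(GRing.opp 1) (oppr_pchar2 (ls_char2 L)) scale1r.
Qed.

Lemma ls_brC (x y : L) : \br[x, y] = \br[y, x].
Proof.
have := ls_brxx (x + y).
rewrite linearDl !linearDr /= !ls_brxx add0r addr0 => /eqP.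
by rewrite addr_eq0 => /eqP ->; rewrite ls_oppr.
Qed.

Lemma ls_brPl (a : K) (x y z : L) :
  \br[a *: x + y, z] = a *: \br[x, z] + \br[y, z].
Proof. exact: linearPl. Qed.

Lemma ls_brPr (a : K) (x y z : L) :
  \br[z, a *: x + y] = a *: \br[z, x] + \br[z, y].
Proof. by rewrite ls_brC ls_brPl !(ls_brC z). Qed.

Lemma ls_brZr (a : K) (x y : L) : \br[x, a *: y] = a *: \br[x, y].
Proof. by have := ls_brPr a y 0 x; rewrite linear0r !addr0. Qed.

Lemma ls_brDr (x y z : L) : \br[x, y + z] = \br[x, y] + \br[x, z].
Proof. by rewrite -[y]scale1r ls_brPr !scale1r. Qed.

Lemma ls_brDl (x y z : L) : \br[x + y, z] = \br[x, z] + \br[y, z].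
Proof. by rewrite ls_brC ls_brDr !(ls_brC z). Qed.

Lemma inner_derivationP (D : 'End(L)) : inner_derivation D -> derivation D.
Proof.
move=> [t tD]; split=> [x y|x xo]; rewrite !tD.
  have /eqP := ls_jacobi t x y.
  rewrite (ls_brC y t) (ls_brC y \br[t, x]) -addrA addr_eq0 ls_oppr.
  by rewrite addrC => /eqP.
by rewrite ls_brC ls_sq_br // (ls_brC x t) ls_brC.
Qed.

Lemma coboundary2P (c : {biscalar L}) (q : L -> K) :
  coboundary2 c q -> cocycle2 c q.
Proof.
case=> f [cf qf]; split=> [x||x y z|x y xo].
- by rewrite cf ls_brxx linear0.
- split=> [a x xo|x y xo yo].
    by rewrite !qf ?memvZ // ls_sqZ // linearZ.
  by rewrite !qf ?memvD // cf ls_sqD // !linearB.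
- rewrite !cf -!linearD /= (ls_brC \br[x, y]) (ls_brC \br[y, z]).
  by rewrite (ls_brC \br[z, x]) -addrA addrC ls_jacobi linear0.
- by rewrite !cf ls_sq_br.
Qed.

End Cohomology.

Section SubSuperalgebra.
Variables (K : fieldType) (L : lieSuperalg2 K).

Definition sub_lieSuperalg (U : {vspace L}) : Prop :=
  [/\ (U <= U :&: ls_even L + U :&: ls_odd L)%VS,
      forall x y, x \in U -> y \in U -> \br[x, y] \in U
    & forall x, x \in U -> x \in ls_odd L -> ls_sq x \in U].

Variables (U : {vspace L}) (subU : sub_lieSuperalg U).

Definition sub_br (x y : subvs_of U) : subvs_of U :=
  vsproj U \br[vsval x, vsval y].

Lemma sub_br_bilinear : bilinear_for *:%R *:%R sub_br.
Proof.
split=> x a y z; rewrite /sub_br.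
  by rewrite linearP /= ls_brPl linearP.
by rewrite !linearP.
Qed.
HB.instance Definition _ := bilinear_isBilinear.Build K (subvs_of U)
  (subvs_of U) (subvs_of U) *:%R *:%R sub_br sub_br_bilinear.

Definition sub_sq (x : subvs_of U) : subvs_of U := vsproj U (ls_sq (vsval x)).

Definition sub_part (W : {vspace L}) : {vspace subvs_of U} :=
  (linfun (vsval : subvs_of U -> L) @^-1: W)%VS.

Lemma mem_sub_part W x : (x \in sub_part W) = (vsval x \in W).
Proof. by rewrite -memv_preim lfunE. Qed.

Lemma val_sub_br x y : vsval (sub_br x y) = \br[vsval x, vsval y].
Proof. by case: subU => _ Ubr _; rewrite vsprojK // Ubr ?subvsP. Qed.

Lemma val_sub_sq x : x \in sub_part (ls_odd L) ->
  vsval (sub_sq x) = ls_sq (vsval x).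
Proof.
by case: subU => _ _ Usq; rewrite mem_sub_part => xo; rewrite vsprojK ?Usq ?subvsP.
Qed.

Definition subLS : lieSuperalg2 K.
Proof.
refine (@LieSuperalg2 K (ls_char2 L) (subvs_of U) (sub_part (ls_even L))
          (sub_part (ls_odd L)) _ _ sub_br _ _ _ _ _ sub_sq _ _ _ _).
- apply/vspaceP=> x; rewrite memvf.
  case: subU => /subvP sU _ _.
  have /memv_addP[y yU [z zU xyz]] := sU _ (subvsP x).
  have /andP[Uy y0] : (y \in U) && (y \in ls_even L) by rewrite -memv_cap.
  have /andP[Uz z1] : (z \in U) && (z \in ls_odd L) by rewrite -memv_cap.
  apply/memv_addP; exists (vsproj U y); first by rewrite mem_sub_part vsprojK.
  exists (vsproj U z); first by rewrite mem_sub_part vsprojK.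
  by apply: subvs_inj; rewrite linearD /= !vsprojK.
- apply/eqP; rewrite -subv0; apply/subvP=> x; rewrite memv_cap !mem_sub_part.
  move=> /andP[x0 x1]; rewrite memv0; apply/eqP/subvs_inj.
  by apply/eqP; rewrite linear0 -memv0 -(ls_direct L) memv_cap x0.
- by move=> x y; rewrite !mem_sub_part val_sub_br; apply: ls_br00.
- by move=> x y; rewrite !mem_sub_part val_sub_br; apply: ls_br01.
- by move=> x y; rewrite !mem_sub_part val_sub_br; apply: ls_br11.
- by move=> x; apply: subvs_inj; rewrite val_sub_br ls_brxx.
- move=> x y z; apply: subvs_inj.
  by rewrite !linearD /= !val_sub_br ls_jacobi.
- move=> x xo; rewrite mem_sub_part val_sub_sq //.
  by apply: ls_sq_even; rewrite -mem_sub_part.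
- move=> a x xo; apply: subvs_inj; rewrite linearZ /= !val_sub_sq ?memvZ //.
  by rewrite linearZ /= ls_sqZ // -mem_sub_part.
- move=> x y xo yo; apply: subvs_inj.
  rewrite !linearB /= val_sub_br !val_sub_sq ?memvD // linearD /=.
  by rewrite ls_sqD // -mem_sub_part.
- move=> x y xo; apply: subvs_inj; rewrite !val_sub_br val_sub_sq //.
  by rewrite ls_sq_br // -mem_sub_part.
Defined.

End SubSuperalgebra.

Section Derived.
Variables (K : fieldType) (L : lieSuperalg2 K).

(* Spanned by brackets of basis vectors and squares of odd basis vectors;     *)
(* derived_spaceP shows that this is the span of all brackets and of all      *)
(* squares of odd elements.                                                   *)
Definition derived_space : {vspace L} :=
  (<<[seq \br[x, y] | x <- vbasis (fullv : {vspace L}),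
                     y <- vbasis (fullv : {vspace L})]>>
   + <<[seq ls_sq x | x <- vbasis (ls_odd L)]>>)%VS.

Lemma derived_br x y : \br[x, y] \in derived_space.
Proof.
rewrite (coord_vbasis (memvf y)) raddf_sum; apply: rpred_sum => j _ /=.
rewrite ls_brZr memvZ // ls_brC (coord_vbasis (memvf x)) raddf_sum.
apply: rpred_sum => i _ /=; rewrite ls_brZr memvZ // ls_brC.
apply: (subvP (addvSl _ _)); apply: memv_span.
by apply: allpairs_f; apply: mem_nth; rewrite size_tuple.
Qed.

Lemma derived_sq x : x \in ls_odd L -> ls_sq x \in derived_space.
Proof.
move=> /coord_vbasis xE.
suff [] : ls_sq x \in derived_space /\ x \in ls_odd L by [].
rewrite xE.
elim/big_ind: _ => [|y z [Dy yo] [Dz zo]|i _].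
- split; last exact: mem0v.
  have := ls_sqZ 0 (mem0v (ls_odd L)); rewrite scaler0 expr0n scale0r => ->.
  exact: mem0v.
- split; last exact: memvD.
  have /eqP := ls_sqD yo zo; rewrite -addrA -opprD eq_sym subr_eq => /eqP ->.
  by rewrite !memvD // derived_br.
- have bi : (vbasis (ls_odd L))`_i \in vbasis (ls_odd L).
    by apply: mem_nth; rewrite size_tuple.
  have bo := vbasis_mem bi; split; last exact: memvZ.
  rewrite ls_sqZ // memvZ //; apply: (subvP (addvSr _ _)).
  by apply: memv_span; apply: map_f.
Qed.

Lemma derived_spaceP (W : {vspace L}) :
  (derived_space <= W)%VS <->
  (forall x y, \br[x, y] \in W) /\
  (forall x, x \in ls_odd L -> ls_sq x \in W).
Proof.
split=> [/subvP DW | [brW sqW]].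
  by split=> [x y | x xo]; apply: DW; [exact: derived_br | exact: derived_sq].
rewrite subv_add; apply/andP; split; apply/span_subvP=> z.
  by case/allpairsP=> p [_ _ ->].
by case/mapP=> x /vbasis_mem xo ->; apply: sqW.
Qed.

Lemma derived_sub : sub_lieSuperalg derived_space.
Proof.
split=> [|x y _ _|x _ xo]; [|exact: derived_br|exact: derived_sq].
apply/derived_spaceP; split=> [x y|x xo]; last first.
  apply: (subvP (addvSl _ _)).
  by rewrite memv_cap derived_sq // ls_sq_even.
have := memvf x; rewrite -ls_full => /memv_addP[x0 hx0 [x1 hx1 ->]].
have := memvf y; rewrite -ls_full => /memv_addP[y0 hy0 [y1 hy1 ->]].
have -> : \br[x0 + x1, y0 + y1] =
    (\br[x0, y0] + \br[x1, y1]) + (\br[x0, y1] + \br[x1, y0]).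
  by rewrite ls_brDl !ls_brDr [X in _ + X]addrC addrACA.
apply: memv_add; rewrite memv_cap memvD ?derived_br //=; apply: memvD.
- exact: ls_br00.
- exact: ls_br11.
- exact: ls_br01.
- by rewrite ls_brC; apply: ls_br01.
Qed.

Definition derivedLS : lieSuperalg2 K := subLS derived_sub.

End Derived.

Section GeneralLinear.
Variables (K : fieldType) (char2 : 2%N \in [pchar K]) (m n : nat).
Implicit Types X Y Z : 'M[K]_(m + n).

Definition diag_part X : 'M[K]_(m + n) :=
  block_mx (ulsubmx X) 0 0 (drsubmx X).
Definition offdiag_part X : 'M[K]_(m + n) :=
  block_mx 0 (ursubmx X) (dlsubmx X) 0.

Lemma diag_part_linear : linear diag_part.
Proof.
move=> a X Y; rewrite /diag_part scale_block_mx add_block_mx.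
by rewrite !scaler0 !addr0 /ulsubmx /drsubmx !linearP.
Qed.
HB.instance Definition _ :=
  GRing.isLinear.Build K 'M[K]_(m + n) 'M[K]_(m + n) *:%R diag_part
    diag_part_linear.

Lemma offdiag_part_linear : linear offdiag_part.
Proof.
move=> a X Y; rewrite /offdiag_part scale_block_mx add_block_mx.
by rewrite !scaler0 !addr0 /ursubmx /dlsubmx !linearP.
Qed.
HB.instance Definition _ :=
  GRing.isLinear.Build K 'M[K]_(m + n) 'M[K]_(m + n) *:%R offdiag_part
    offdiag_part_linear.

Definition gl_even : {vspace 'M[K]_(m + n)} := lker (linfun offdiag_part).
Definition gl_odd : {vspace 'M[K]_(m + n)} := lker (linfun diag_part).

Lemma diag_offdiagD X : diag_part X + offdiag_part X = X.
Proof.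
by rewrite /diag_part /offdiag_part add_block_mx !add0r !addr0 submxK.
Qed.

Lemma gl_evenP X : reflect (X = diag_part X) (X \in gl_even).
Proof.
rewrite memv_ker lfunE /=; apply: (iffP eqP) => [X0 | ->].
  by rewrite -{1}(diag_offdiagD X) X0 addr0.
by rewrite /offdiag_part block_mxKur block_mxKdl block_mx0.
Qed.

Lemma gl_oddP X : reflect (X = offdiag_part X) (X \in gl_odd).
Proof.
rewrite memv_ker lfunE /=; apply: (iffP eqP) => [X0 | ->].
  by rewrite -{1}(diag_offdiagD X) X0 add0r.
by rewrite /diag_part block_mxKul block_mxKdr block_mx0.
Qed.

Lemma diag_part_even X : diag_part X \in gl_even.
Proof. by apply/gl_evenP; rewrite /diag_part block_mxKul block_mxKdr. Qed.

Lemma offdiag_part_odd X : offdiag_part X \in gl_odd.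
Proof. by apply/gl_oddP; rewrite /offdiag_part block_mxKur block_mxKdl. Qed.

Lemma gl_full : (gl_even + gl_odd = fullv)%VS.
Proof.
apply/vspaceP=> X; rewrite memvf -(diag_offdiagD X).
by rewrite memv_add ?diag_part_even ?offdiag_part_odd.
Qed.

Lemma gl_direct : (gl_even :&: gl_odd = 0)%VS.
Proof.
apply/eqP; rewrite -subv0; apply/subvP=> X; rewrite memv_cap !memv_ker memv0.
by rewrite !lfunE /= => /andP[/eqP X0 /eqP X1]; rewrite -(diag_offdiagD X) X0 X1 addr0.
Qed.

Lemma gl_mul00 X Y : X \in gl_even -> Y \in gl_even -> X *m Y \in gl_even.
Proof.
move=> /gl_evenP -> /gl_evenP ->; apply/gl_evenP.
rewrite /diag_part mulmx_block !(mulmx0, mul0mx, addr0, add0r).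
by rewrite block_mxKul block_mxKdr.
Qed.

Lemma gl_mul01 X Y : X \in gl_even -> Y \in gl_odd -> X *m Y \in gl_odd.
Proof.
move=> /gl_evenP -> /gl_oddP ->; apply/gl_oddP.
rewrite /diag_part /offdiag_part mulmx_block !(mulmx0, mul0mx, addr0, add0r).
by rewrite block_mxKur block_mxKdl.
Qed.

Lemma gl_mul10 X Y : X \in gl_odd -> Y \in gl_even -> X *m Y \in gl_odd.
Proof.
move=> /gl_oddP -> /gl_evenP ->; apply/gl_oddP.
rewrite /diag_part /offdiag_part mulmx_block !(mulmx0, mul0mx, addr0, add0r).
by rewrite block_mxKur block_mxKdl.
Qed.

Lemma gl_mul11 X Y : X \in gl_odd -> Y \in gl_odd -> X *m Y \in gl_even.
Proof.
move=> /gl_oddP -> /gl_oddP ->; apply/gl_evenP.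
rewrite /diag_part /offdiag_part mulmx_block !(mulmx0, mul0mx, addr0, add0r).
by rewrite block_mxKul block_mxKdr.
Qed.

Lemma opp_mx_char2 X : - X = X.
Proof. by rewrite -scaleN1r (oppr_pchar2 char2) scale1r. Qed.

Lemma addmx_char2 X : X + X = 0.
Proof. by rewrite -{1}[X]opp_mx_char2 addNr. Qed.

(* In characteristic 2 this is the supercommutator for all parities. *)
Definition gl_br X Y : 'M[K]_(m + n) := X *m Y - Y *m X.

Lemma gl_br_bilinear : bilinear_for *:%R *:%R gl_br.
Proof.
split=> X a Y Z; rewrite /gl_br mulmxDl mulmxDr -scalemxAl -scalemxAr.
  by rewrite opprD addrACA /= scalerBr.
by rewrite opprD addrACA /= scalerBr.
Qed.
HB.instance Definition _ := bilinear_isBilinear.Build K 'M[K]_(m + n)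
  'M[K]_(m + n) 'M[K]_(m + n) *:%R *:%R gl_br gl_br_bilinear.

Definition glLS : lieSuperalg2 K.
Proof.
refine (@LieSuperalg2 K char2 'M[K]_(m + n) gl_even gl_odd gl_full gl_direct
          gl_br _ _ _ _ _ (fun X => X *m X) _ _ _ _).
- by move=> X Y X0 Y0; apply: memvB; apply: gl_mul00.
- by move=> X Y X0 Y0; apply: memvB; [apply: gl_mul01 | apply: gl_mul10].
- by move=> X Y X0 Y0; apply: memvB; apply: gl_mul11.
- by move=> X; rewrite /= /gl_br subrr.
- move=> X Y Z; rewrite /= /gl_br !mulmxBl !mulmxBr !mulmxA !opprB.
  by rewrite !addrA; apply/matrixP=> i j; rewrite !mxE; ring.
- by move=> X X1; apply: gl_mul11.
- by move=> a X _; rewrite -scalemxAl -scalemxAr scalerA.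
- move=> X Y _ _; rewrite /= /gl_br [- (Y *m X)]opp_mx_char2 mulmxDl !mulmxDr.
  by rewrite [_ - X *m X]addrC !addrA addNr add0r addrK.
- move=> X Y _; rewrite /= /gl_br !mulmxBl !mulmxBr !mulmxA opprB addrACA.
  by rewrite -opprD addmx_char2 oppr0 addr0 [- (Y *m X *m X)]opp_mx_char2.
Defined.

Variables (B0 : 'M[K]_m) (B1 : 'M[K]_n).

Definition even_form : 'M[K]_(m + n) := block_mx B0 0 0 B1.

(* In characteristic 2 the supertranspose is the plain transpose. *)
Definition oo_defect X : 'M[K]_(m + n) := X^T *m even_form + even_form *m X.

Lemma oo_defect_linear : linear oo_defect.
Proof.
move=> a X Y; rewrite /oo_defect linearP /= mulmxDl mulmxDr.
by rewrite -scalemxAl -scalemxAr addrACA scalerDr.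
Qed.
HB.instance Definition _ :=
  GRing.isLinear.Build K 'M[K]_(m + n) 'M[K]_(m + n) *:%R oo_defect
    oo_defect_linear.

Definition oo_space : {vspace glLS} := lker (linfun oo_defect).

Lemma oo_spaceP X :
  reflect (X^T *m even_form + even_form *m X = 0) (X \in oo_space).
Proof. by rewrite memv_ker lfunE; apply: eqP. Qed.

Lemma oo_sub : sub_lieSuperalg oo_space.
Proof.
have ooE X : X \in oo_space -> X^T *m even_form = even_form *m X.
  by move/oo_spaceP/eqP; rewrite addr_eq0 opp_mx_char2 => /eqP.
have ooI X : X^T *m even_form = even_form *m X -> X \in oo_space.
  by move=> XB; apply/oo_spaceP; rewrite XB -{1}[_ *m X]opp_mx_char2 addNr.
have oo2 X Y : X \in oo_space -> Y \in oo_space ->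
    (X *m Y)^T *m even_form = even_form *m (Y *m X).
  by move=> Xo Yo; rewrite trmx_mul -mulmxA ooE // mulmxA ooE // mulmxA.
split=> [|X Y Xo Yo|X Xo _].
- apply/subvP=> X /ooE XB; rewrite -(diag_offdiagD X).
  move: XB; rewrite -{1 2}(submxK X) tr_block_mx /even_form !mulmx_block.
  rewrite !(mulmx0, mul0mx, addr0, add0r) => /eq_block_mx[e1 e2 e3 e4].
  apply: memv_add; rewrite memv_cap ?diag_part_even ?offdiag_part_odd andbT;
    apply: ooI; rewrite tr_block_mx !trmx0 !mulmx_block;
    rewrite !(mulmx0, mul0mx, addr0, add0r).
  + by rewrite e1 e4.
  + by rewrite e2 e3.
- apply: ooI; rewrite /= /gl_br linearB /= mulmxBl mulmxBr !oo2 //.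
  by rewrite -[LHS]opp_mx_char2 opprB.
- by apply: ooI; rewrite oo2.
Qed.

Definition ooLS : lieSuperalg2 K := subLS oo_sub.

End GeneralLinear.

Definition Pi4 (K : fieldType) : 'M[K]_4 := block_mx 0 (1%:M : 'M_2) 1%:M 0.

Definition oo_IPi_1_4 (K : fieldType) (char2 : 2%N \in [pchar K]) :
    lieSuperalg2 K :=
  ooLS char2 (1%:M : 'M_1) (Pi4 K).

Definition oo1_IPi_1_4 (K : fieldType) (char2 : 2%N \in [pchar K]) :
    lieSuperalg2 K :=
  derivedLS (oo_IPi_1_4 char2).

(* Main.v *)
(* Identify [g] with the symmetric matrices [S = B X] having [S_00 = 0]: the
   odd part is a 4-dimensional symplectic space with basis [e_i], the squares
   [e_i^2] and the brackets [[e_i, e_j]] span the even part,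
   [[e_i^2, y] = [e_i, [e_i, y]]] and [[e_i^2, e_j] = <e_i, e_j> e_i].
   A derivation [D] is therefore determined by the [D e_i], and applying [D]
   to the last relation gives linear equations on their coordinates that force
   [D e_i = [y, e_i]] for a single [y].  For a cocycle [(c, q)], set
   [f (e_i^2) = q e_i], [f [e_i, e_j] = c (e_i, e_j)] and
   [f e_i = c (e_i^2, e_i')], where [e_i'] is the basis vector paired with
   [e_i].  The cocycle identities then give [c (e_i, y) = f [e_i, y]] for all
   [y], and since the [e_i] generate [g] the cocycle is the coboundary of [f]. *)

From HB Require Import structures.
Require Import Defs.
From mathcomp Require Import all_boot all_order all_algebra.
From mathcomp Require Import ring.

Set Implicit Arguments.
Unset Strict Implicit.
Unset Printing Implicit Defensive.

Import GRing.Theory.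
Local Open Scope ring_scope.

(** * Superalgebras generated by odd vectors [e i], described by coordinates [v] (odd part) and [m]
    (even part) *)

Section Coordinates.
Variables (K : fieldType) (L : lieSuperalg2 K) (n : nat).
Variables (p : 'I_n -> 'I_n) (e : 'I_n -> L).
Variables (v : L -> 'I_n -> K) (m : L -> 'I_n -> 'I_n -> K).
Hypotheses (pK : involutive p) (p_neq : forall i, p i != i).
Hypothesis e_odd : forall i, e i \in ls_odd L.
Hypothesis vP : forall a x y i, v (a *: x + y) i = a * v x i + v y i.
Hypothesis mP :
  forall a x y i j, m (a *: x + y) i j = a * m x i j + m y i j.
Hypothesis m_sym : forall x i j, m x i j = m x j i.
Hypothesis coord_inj :
  forall x, (forall i, v x i = 0) -> (forall i j, m x i j = 0) -> x = 0.
Hypothesis v_e : forall i j, v (e i) j = (j == i)%:R.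
Hypothesis m_e : forall i a b, m (e i) a b = 0.
Hypothesis v_sq : forall i j, v (ls_sq (e i)) j = 0.
Hypothesis m_sq :
  forall i a b, m (ls_sq (e i)) a b = (a == i)%:R * (b == i)%:R.
Hypothesis v_br : forall i y b, v \br[e i, y] b = m y (p i) b.
Hypothesis m_br : forall i y a b,
  m \br[e i, y] a b = (a == i)%:R * v y b + (b == i)%:R * v y a.
Hypothesis m_odd : forall x i j, x \in ls_odd L -> m x i j = 0.

Let addKK (x : K) : x + x = 0. Proof. exact: addrr_pchar2 (ls_char2 L) x. Qed.
Let oppK (x : K) : - x = x. Proof. exact: oppr_pchar2 (ls_char2 L) x. Qed.

Let eq_pC i j : (i == p j) = (j == p i).
Proof. by rewrite -(inj_eq (inv_inj pK)) pK eq_sym. Qed.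

Let v0 i : v 0 i = 0.
Proof. by have := vP 1 0 0 i; rewrite scale1r addr0 mul1r addKK. Qed.
Let m0 i j : m 0 i j = 0.
Proof. by have := mP 1 0 0 i j; rewrite scale1r addr0 mul1r addKK. Qed.
Let vZ a x i : v (a *: x) i = a * v x i.
Proof. by have := vP a x 0 i; rewrite v0 !addr0. Qed.
Let mZ a x i j : m (a *: x) i j = a * m x i j.
Proof. by have := mP a x 0 i j; rewrite m0 !addr0. Qed.
Let vD x y i : v (x + y) i = v x i + v y i.
Proof. by have := vP 1 x y i; rewrite scale1r mul1r. Qed.
Let mD x y i j : m (x + y) i j = m x i j + m y i j.
Proof. by have := mP 1 x y i j; rewrite scale1r mul1r. Qed.
Let v_sum (I : finType) (P : pred I) (F : I -> L) i :
  v (\sum_(j | P j) F j) i = \sum_(j | P j) v (F j) i.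
Proof. by apply: (big_morph (fun x => v x i)) => [x y|]; rewrite ?vD ?v0. Qed.
Let m_sum (I : finType) (P : pred I) (F : I -> L) i k :
  m (\sum_(j | P j) F j) i k = \sum_(j | P j) m (F j) i k.
Proof. by apply: (big_morph (fun x => m x i k)) => [x y|]; rewrite ?mD ?m0. Qed.

Lemma coord_eq x y :
  (forall i, v x i = v y i) -> (forall i j, m x i j = m y i j) -> x = y.
Proof.
move=> vxy mxy; apply/eqP; rewrite -subr_eq0 (ls_oppr y); apply/eqP.
by apply: coord_inj => [i|i j]; rewrite (vD, mD) (vxy, mxy) addKK.
Qed.

Lemma sum_eqr (F : 'I_n -> K) (j : 'I_n) :
  \sum_i F i * (j == i)%:R = F j.
Proof.
rewrite (bigD1 j) //= eqxx mulr1 big1 ?addr0 // => i.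
by rewrite eq_sym => /negbTE ->; rewrite mulr0.
Qed.

(** The bracket of [e a] and [e b] has matrix [E_ab + E_ba], so this is the [(i, j)] entry of a
    combination of brackets over unordered pairs. Off the diagonal exactly one of [i < j], [j < i]
    holds, so one term survives. *)
Lemma sum_ltn_pairs (G : 'I_n -> 'I_n -> K) i j :
  (forall a b, G a b = G b a) ->
  \sum_(a < n) \sum_(b < n | (a < b)%N)
    G a b * ((i == a)%:R * (j == b)%:R + (j == a)%:R * (i == b)%:R)
  = (i != j)%:R * G i j.
Proof.
move=> G_sym; pose H (a b : 'I_n) := (a < b)%N%:R * G a b.
transitivity (H i j + H j i).
  rewrite -(sum_eqr (H ^~ j) i) -(sum_eqr (H ^~ i) j) -big_split /=.
  apply: eq_bigr => a _; rewrite -(sum_eqr (H a) j) -(sum_eqr (H a) i).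
  rewrite !mulr_suml -big_split big_mkcond /=; apply: eq_bigr => b _.
  by rewrite /H; case: ifP => _; rewrite ?mul1r ?mul0r ?addr0 //; ring.
rewrite /H (G_sym j) -mulrDl -(inj_eq val_inj) /=.
by case: ltngtP => _; rewrite (add0r, addr0).
Qed.

(** The diagonal of [s] must be carried by the squares, because the brackets [[e_i, e_i]] vanish. *)
Definition of_coord (a : 'I_n -> K) (s : 'I_n -> 'I_n -> K) : L :=
  \sum_i a i *: e i + \sum_i s i i *: ls_sq (e i)
  + \sum_(i < n) \sum_(j < n | (i < j)%N) s i j *: \br[e i, e j].

Lemma v_of_coord a s i : v (of_coord a s) i = a i.
Proof.
rewrite !vD !v_sum; under eq_bigr do rewrite vZ v_e.
rewrite sum_eqr big1 => [|j _]; last by rewrite vZ v_sq mulr0.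
rewrite big1 ?addr0 // => j _; rewrite v_sum big1 // => k _.
by rewrite vZ v_br m_e mulr0.
Qed.

Lemma m_of_coord a s (s_sym : forall i j, s i j = s j i) i j :
  m (of_coord a s) i j = s i j.
Proof.
rewrite !mD !m_sum big1 ?add0r => [|k _]; last by rewrite mZ m_e mulr0.
under eq_bigr do rewrite mZ m_sq mulrA.
rewrite sum_eqr.
transitivity ((i == j)%:R * s i j + (i != j)%:R * s i j); last first.
  by case: eqP; rewrite mul0r mul1r (addr0, add0r).
congr (_ + _).
  by have [->|_] := eqVneq i j; rewrite ?mul1r ?mul0r ?mulr1 ?mulr0 ?eqxx.
rewrite -sum_ltn_pairs //; apply: eq_bigr => k _; rewrite m_sum.
by apply: eq_bigr => l _; rewrite mZ m_br !v_e.
Qed.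

Lemma of_coordK x : of_coord (v x) (m x) = x.
Proof.
by apply: coord_eq => [i|i j]; rewrite ?v_of_coord ?m_of_coord.
Qed.

Lemma coord_ind (P : L -> Prop) :
  P 0 -> (forall a x y, P x -> P y -> P (a *: x + y)) ->
  (forall i, P (e i)) -> (forall i, P (ls_sq (e i))) ->
  (forall i j, P \br[e i, e j]) -> forall x, P x.
Proof.
move=> P0 PP Pe Psq Pbr x; rewrite -(of_coordK x).
have PD y z : P y -> P z -> P (y + z) by move=> Py /(PP 1 _ _ Py); rewrite scale1r.
have PZ a y : P y -> P (a *: y) by move=> /(PP a)/(_ P0); rewrite addr0.
have Psum (Q : pred 'I_n) F : (forall i, P (F i)) -> P (\sum_(i | Q i) F i).
  by move=> PF; apply: big_ind.
rewrite /of_coord; apply: (PD); first apply: (PD); apply: (Psum) => i; auto.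
Qed.

(** * Derivations and the vanishing of the first cohomology *)

Lemma derivation_inner (D : 'End(L)) (y : L) : derivation D ->
  (forall i, D (e i) = \br[y, e i]) -> forall x, D x = \br[y, x].
Proof.
move=> [Dbr Dsq] De; elim/coord_ind.
- by rewrite linear0 linear0r.
- by move=> a x z Dx Dz; rewrite linearP /= Dx Dz ls_brPr.
- by [].
- by move=> i; rewrite Dsq // De ls_brC (ls_brC y) (ls_brC y) ls_sq_br.
- move=> i j; rewrite Dbr !De; have /eqP := ls_jacobi y (e i) (e j).
  rewrite -addrA addr_eq0 ls_oppr => /eqP ->.
  by rewrite addrC (ls_brC y) (ls_brC _ (e j)) (ls_brC y).
Qed.

(** With the symplectic form [<e_i, e_j> = (i == p j)], the bracket [[e_i, e_k]] acts on odd [x] as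
    [<x, e_i> e_k + <x, e_k> e_i]. *)
Lemma br_e3 i j k :
  \br[e j, \br[e i, e k]] = (i == p j)%:R *: e k + (k == p j)%:R *: e i.
Proof.
apply: coord_eq => [b|a b].
  rewrite v_br m_br vD !vZ !v_e (eq_sym i) (eq_sym k); ring.
by rewrite m_br !v_br mD !mZ !m_e !mulr0.
Qed.

Lemma br_sq_e i j : \br[ls_sq (e i), e j] = (j == p i)%:R *: e i.
Proof.
by rewrite ls_sq_br // br_e3 eq_sym (negbTE (p_neq i)) scale0r add0r.
Qed.

(* [D] applied to the defining relation [[e_i^2, e_j] = <e_i, e_j> e_i]. *)
Lemma derivation_cubic (D : 'End(L)) i j : derivation D ->
  \br[e j, \br[e i, D (e i)]] + \br[e i, \br[e i, D (e j)]] =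
  (j == p i)%:R *: D (e i).
Proof.
move=> [Dbr Dsq]; rewrite -linearZ -br_sq_e /= Dbr Dsq // ls_sq_br //.
by rewrite ls_brC (ls_brC (e i) (D (e i))).
Qed.

Lemma H1_of_coord : (2 < n)%N -> H1_adjoint_eq0 L.
Proof.
move=> n_gt2 D derD.
have pE i j : (p i == j) = (i == p j) by rewrite -{1}(pK j) (inj_eq (inv_inj pK)).
(* An index outside the pair [{i, p i}] gives a cubic relation with zero right-hand side; this is
   where [2 < n] enters. *)
have other i : exists j, (j != i) && (j != p i).
  have : (#|[set i; p i]| < #|[set: 'I_n]|)%N.
    by rewrite cardsT card_ord (leq_ltn_trans _ n_gt2) // cards2; case: (_ != _).
  rewrite ltnNge => /negP nle.
  have /subsetPn[j _ jn] : ~~ ([set: 'I_n] \subset [set i; p i]).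
    by apply/negP => /subset_leq_card.
  by exists j; move: jn; rewrite !inE negb_or.
pose w i := v (D (e i)); pose t i := m (D (e i)).
have tC i a b : t i a b = t i b a by exact: m_sym.
(* In the [i]-th odd coordinate of the cubic relation the terms in [w i i] cancel. What remains says
   that the matrix [w (p a) b] is symmetric, so it can serve as the even part of [y]. *)
have wE i j : w i (p j) = w j (p i).
  have := congr1 (v ^~ i) (derivation_cubic i j derD).
  rewrite vD vZ !v_br !m_br eqxx (negbTE (p_neq i)) pE !mul1r mul0r add0r -addrA.
  move/eqP; rewrite -subr_eq0 addrAC subrr add0r addr_eq0 oppK => /eqP.
  by [].
have tE i j a b : (a == j)%:R * t i (p i) b + (b == j)%:R * t i (p i) a +
   ((a == i)%:R * t j (p i) b + (b == i)%:R * t j (p i) a) = (j == p i)%:R * t i a b.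
  have := congr1 (fun x => m x a b) (derivation_cubic i j derD).
  by rewrite mD mZ !m_br !v_br.
(* If [D e_i = [y, e_i]], then [t i a b] is [(a == i) y_b + (b == i) y_a]. Taking [i = p b] and the
   entry [(b, p b)] isolates [y_b], which dictates [u]. *)
pose u b := t (p b) b (p b).
have uE i j : j != i -> j != p i -> t j (p i) j = u (p i).
  move=> ji jpi; have := tE i j j i; rewrite eqxx (negbTE jpi) (negbTE ji).
  rewrite (eq_sym i) (negbTE ji) eqxx !mul1r !mul0r add0r addr0 => /eqP.
  by rewrite addr_eq0 oppK /u pK => /eqP.
have t0 i b : b != i -> t i (p i) b = 0.
  move=> bi; have [->|bpi] := eqVneq b (p i).
    (* The entry [(j, p i)] of the relation for [i] and the third index [j] contains only
       [t i (p i) (p i)]. *)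
    have [j /andP[ji jpi]] := other i.
    have := tE i j j (p i); rewrite eqxx (negbTE jpi) (negbTE ji) (negbTE (p_neq i)).
    by rewrite (eq_sym _ j) (negbTE jpi) !mul1r !mul0r !addr0.
  have := tE i (p b) (p b) b; rewrite (inj_eq (inv_inj pK) b i) (pE b i).
  rewrite eqxx (eq_sym b (p b)) !(negbTE (p_neq _)) (negbTE bi) (negbTE bpi).
  by rewrite mul1r !mul0r !addr0.
(* The relation for [j = p i] expresses every entry of [t i] through row [p i] of [t i] and of
   [t (p i)]; these two rows are computed as [t1] and [t3]. *)
have tu i a b : t i a b = (a == i)%:R * u b + (b == i)%:R * u a.
  have t1 k l : t k (p k) l = (l == k)%:R * u (p k).
    by have [->|/t0->] := eqVneq l k; rewrite ?mul0r // mul1r /u pK.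
  have := tE i (p i) a b; rewrite eqxx mul1r => <-.
  rewrite !t1.
  have t3 l : t (p i) (p i) l = if l == p i then 0 else u l.
    case: (eqVneq l (p i)) => [->|lpi].
      (* On a diagonal entry each term on the left occurs twice, so the right-hand side
         [t (p i) (p i) (p i)] vanishes. *)
      have := tE (p i) i (p i) (p i).
      by rewrite pK !addKK eqxx mul1r => <-.
    have [->|li] := eqVneq l i; first by rewrite tC /u.
    have := uE (p l) (p i); rewrite pK (inj_eq (inv_inj pK)) tC.
    by apply; rewrite eq_sym.
  rewrite !t3.
  have [->|bpi] := eqVneq b (p i); have [->|api] := eqVneq a (p i);
   rewrite ?(negbTE (p_neq i)) ?mulr0 ?mul0r ?mul1r ?add0r ?addr0 //.
pose y := of_coord u (fun a b => w (p a) b).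
have ysym a b : w (p a) b = w (p b) a by rewrite -{1}(pK b) wE pK.
exists y; apply: derivation_inner => // i.
rewrite ls_brC; apply: coord_eq => [b|a b].
  by rewrite v_br m_of_coord // pK.
by rewrite m_br !v_of_coord -/(t i a b) tu.
Qed.

(** * Two-cocycles and the construction of a primitive *)

Section Cocycle.
Variables (c : {biscalar L}) (q : L -> K) (cq : cocycle2 c q).

Let cPl a x y z : c (a *: x + y) z = a * c x z + c y z.
Proof. exact: linearPl. Qed.
Let cPr a x y z : c z (a *: x + y) = a * c z x + c z y.
Proof. exact: linearPr. Qed.
Let c0l x : c 0 x = 0. Proof. exact: linear0l. Qed.
Let c0r x : c x 0 = 0. Proof. exact: linear0r. Qed.
Let cDl x y z : c (x + y) z = c x z + c y z. Proof. exact: linearDl. Qed.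
Let cDr x y z : c z (x + y) = c z x + c z y. Proof. exact: linearDr. Qed.
Let cZr a x z : c z (a *: x) = a * c z x. Proof. exact: linearZr. Qed.

Lemma cocycle_sym x y : c x y = c y x.
Proof.
have [cxx _ _ _] := cq; have := cxx (x + y).
rewrite cDl !cDr !cxx add0r addr0 => /eqP.
by rewrite addr_eq0 oppK => /eqP.
Qed.

Lemma cocycle_br x y z : c \br[x, y] z = c x \br[y, z] + c y \br[z, x].
Proof.
have [_ _ jac _] := cq; have /eqP := jac x y z.
rewrite -addrA addr_eq0 oppK => /eqP ->.
by rewrite (cocycle_sym x) (cocycle_sym y).
Qed.

(** The value at [e i] forced on any primitive, since [[e_i^2, e_(p i)] = e_i]. *)
Definition e_form i := c (ls_sq (e i)) (e (p i)).

Lemma br_sq_sq i j :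
  \br[ls_sq (e i), ls_sq (e j)] = (j == p i)%:R *: \br[e i, e j].
Proof.
rewrite ls_sq_br // [\br[e i, ls_sq _]]ls_brC br_sq_e eq_sym.
by rewrite -(inj_eq (inv_inj pK)) pK ls_brZr.
Qed.

(** For [i] outside [{j, p j}], write [e_i = [e_i^2, e_(p i)]] and apply the cocycle identity to
    [e_j^2], [e_i^2], [e_(p i)]: both [[e_j^2, e_i^2]] and [[e_j^2, e_(p i)]] vanish. *)
Lemma c_e_sq i j : c (e i) (ls_sq (e j)) = (i == p j)%:R * e_form j.
Proof.
have [cxx _ _ csq] := cq; rewrite cocycle_sym.
have [->|ipj] := eqVneq i (p j); first by rewrite mul1r.
have [->|ij] := eqVneq i j; first by rewrite csq // ls_brxx c0r mul0r.
have := cocycle_br (ls_sq (e j)) (ls_sq (e i)) (e (p i)).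
rewrite br_sq_sq (negbTE ipj) scale0r c0l !(br_sq_e, ls_brC (e _)) eqxx.
rewrite scale1r (inj_eq (inv_inj pK)) (negbTE ij) scale0r c0r addr0 mul0r.
by move=> <-.
Qed.

(** Obtained from [[e_i, e_j] = [e_i^2, [e_(p i), e_j]]]; one value of [c] of the same kind is left
    over. *)
Let c_e_br_neq i j k : j != i -> j != p i ->
  c \br[e i, e j] (e k) = (k == p j)%:R * e_form i
     + (k == p i)%:R * c \br[e (p i), e j] (e i).
Proof.
move=> ji jpi.
have {1}<- : \br[ls_sq (e i), \br[e (p i), e j]] = \br[e i, e j].
  by rewrite ls_sq_br // br_e3 eqxx (negbTE jpi) scale1r scale0r addr0.
rewrite cocycle_br [\br[\br[_, _], _]]ls_brC br_e3 [\br[e k, _]]ls_brC br_sq_e.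
rewrite cDr !cZr !(cocycle_sym (ls_sq _)) !c_e_sq (negbTE jpi) eqxx.
rewrite mul0r mulr0 add0r mul1r; congr (_%:R * _ + _).
by rewrite -(inj_eq (inv_inj pK)) pK eq_sym.
Qed.

(** For [j] outside [{i, p i}], a second use of [c_e_br_neq] with the roles of the two vectors
    exchanged evaluates the leftover term as [e_form j]. For [j = p i] the bracket is
    [[e_i^2, e_(p i)^2]], and the cocycle identity reduces to [c_e_sq]. *)
Lemma c_br_e i j k : c \br[e i, e j] (e k) =
  (k == p j)%:R * e_form i + (k == p i)%:R * e_form j.
Proof.
have [->|ji] := eqVneq j i; first by rewrite ls_brxx c0l addKK.
have [->|jpi] := eqVneq j (p i).
  have := cocycle_br (ls_sq (e i)) (ls_sq (e (p i))) (e k).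
  rewrite br_sq_sq eqxx scale1r => ->.
  rewrite [\br[e k, _]]ls_brC !br_sq_e pK !cZr !(cocycle_sym (ls_sq _)) !c_e_sq.
  by rewrite pK !eqxx !mul1r addrC.
have ipj : i != p j by rewrite -(inj_eq (inv_inj pK)) pK eq_sym.
rewrite c_e_br_neq // ls_brC c_e_br_neq ?(inj_eq (inv_inj pK)) ?[p i == j]eq_sym //;
  last by rewrite eq_sym.
by rewrite pK eqxx mul1r (negbTE ipj) mul0r addr0.
Qed.

(** The diagonal of [m x] carries the squares and is therefore weighted by [q], whose values there
    [c] does not determine. *)
Definition primitive x :=
  \sum_i v x i * e_form i + \sum_i m x i i * q (e i)
  + \sum_(i < n) \sum_(j < n | (i < j)%N) c (e i) (e j) * m x i j.

Lemma primitive_is_linear : linear_for *%R primitive.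
Proof.
move=> a x y.
have sumP (Q : pred 'I_n) (F G H : 'I_n -> K) :
    (forall i, F i = a * G i + H i) ->
    \sum_(i | Q i) F i = a * \sum_(i | Q i) G i + \sum_(i | Q i) H i.
  by move=> FE; rewrite mulr_sumr -big_split; apply: eq_bigr => i _.
pose F1 z i := v z i * e_form i; pose F2 z i := m z i i * q (e i).
pose F3 z (i j : 'I_n) := c (e i) (e j) * m z i j.
pose F4 z (i : 'I_n) := \sum_(j < n | (i < j)%N) F3 z i j.
have primE z : primitive z =
  \sum_i F1 z i + \sum_i F2 z i + \sum_(i < n) F4 z i by [].
rewrite !primE.
rewrite (sumP _ (F1 (a *: x + y)) (F1 x) (F1 y)) => [|i];
  last by rewrite /F1 vP; ring.
rewrite (sumP _ (F2 (a *: x + y)) (F2 x) (F2 y)) => [|i];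
  last by rewrite /F2 mP; ring.
rewrite (sumP _ (F4 (a *: x + y)) (F4 x) (F4 y)) => [|i].
  by rewrite /=; ring.
by apply: sumP => j; rewrite /F3 mP; ring.
Qed.
HB.instance Definition _ :=
  GRing.isLinear.Build K L K *%R primitive primitive_is_linear.

Lemma primitive_e i : primitive (e i) = e_form i.
Proof.
rewrite /primitive; under eq_bigr do rewrite v_e mulrC eq_sym.
rewrite sum_eqr big1 => [|j _]; last by rewrite m_e mul0r.
by rewrite big1 ?addr0 // => j _; rewrite big1 // => k _; rewrite m_e mulr0.
Qed.

Let sum_neq_pairs (G : 'I_n -> 'I_n -> K) :
  (forall i j, i != j -> G i j = 0) ->
  \sum_(i < n) \sum_(j < n | (i < j)%N) G i j = 0.
Proof.
move=> G0; rewrite big1 // => i _; rewrite big1 // => j ij.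
by rewrite G0 // -(inj_eq val_inj) /= ltn_eqF.
Qed.

Lemma primitive_sq i : primitive (ls_sq (e i)) = q (e i).
Proof.
rewrite /primitive big1 ?add0r => [|j _]; last by rewrite v_sq mul0r.
rewrite sum_neq_pairs ?addr0 => [|j k jk]; last first.
  by rewrite m_sq; have [<-|] := eqVneq j i; rewrite ?[k == _]eq_sym
    ?(negbTE jk) !(mulr0, mul0r).
rewrite -[RHS](sum_eqr (fun j => q (e j))); apply: eq_bigr => j _.
by rewrite m_sq -natrM mulnb andbb mulrC eq_sym.
Qed.

Lemma primitive_br i j : primitive \br[e i, e j] = c (e i) (e j).
Proof.
have [cxx _ _ _] := cq.
rewrite /primitive big1 ?add0r => [|k _]; last by rewrite v_br m_e mul0r.
(* A diagonal entry of the matrix of a bracket is a doubled product, hence zero in characteristic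
   2. *)
rewrite big1 ?add0r => [|k _]; last first.
  by rewrite m_br !v_e mulrC [_%:R * _]mulrC addKK mulr0.
transitivity ((i != j)%:R * c (e i) (e j)); last first.
  by have [->|_] := eqVneq i j; rewrite ?cxx ?mulr0 ?mul1r.
rewrite -(sum_ltn_pairs (G := fun i j => c (e i) (e j))) => [|k l]; last first.
  exact: cocycle_sym.
apply: eq_bigr => k _; apply: eq_bigr => l _; rewrite m_br !v_e; congr (_ * _).
by rewrite ![_ == k]eq_sym ![_ == l]eq_sym; ring.
Qed.

(** The case [x = e i] is checked on the basis in [y]; the square and cyclic identities then carry
    it to [x = e_i^2] and [x = [e_i, e_j]]. *)
Lemma coboundary_br x y : c x y = primitive \br[x, y].
Proof.
have [cxx _ _ csq] := cq; pose f : {scalar L} := primitive.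
rewrite -[RHS]/(f _).
have ce i z : c (e i) z = f \br[e i, z].
  elim/coord_ind: z => [|a z t cz ct|j|j|j k].
  - by rewrite c0r linear0r linear0.
  - by rewrite cPr cz ct ls_brPr linearP.
  - by rewrite [RHS]primitive_br.
  - by rewrite c_e_sq ls_brC br_sq_e linearZ /= primitive_e.
  - by rewrite cocycle_sym c_br_e br_e3 linearP linearZ /= !primitive_e
(eq_pC i j) (eq_pC i k) addrC.
elim/coord_ind: x y => [|a x z cx cz|i|i|i j] y.
- by rewrite c0l linear0l linear0.
- by rewrite cPl cx cz ls_brPl linearP.
- by [].
- by rewrite csq // ce ls_sq_br.
- rewrite cocycle_br !ce -linearD /= (ls_brC \br[e i, _]) (ls_brC _ y).
  have /eqP := ls_jacobi y (e i) (e j).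
  by rewrite -addrA addr_eq0 ls_oppr => /eqP ->; rewrite (ls_brC y).
Qed.

(** Both sides are quadratic on the odd part with polar form [c], so agreement on the [e i]
    suffices. The induction carries oddness along, because the quadratic laws hold only there. *)
Lemma coboundary_sq x : x \in ls_odd L -> q x = primitive (ls_sq x).
Proof.
move=> x_odd; pose f : {scalar L} := primitive; rewrite -[RHS]/(f _).
have [_ [qZ qD] _ _] := cq.
have -> : x = \sum_i v x i *: e i.
  rewrite -{1}(of_coordK x) /of_coord [X in _ + X + _]big1 ?addr0 => [|i _].
    rewrite [X in _ + X]big1 ?addr0 // => i _.
    by rewrite big1 // => j _; rewrite m_odd // scale0r.
  by rewrite m_odd // scale0r.
suff [] : \sum_i v x i *: e i \in ls_odd L /\
   q (\sum_i v x i *: e i) = f (ls_sq (\sum_i v x i *: e i)) by [].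
elim/big_ind: _ => [|y z [y_odd qy] [z_odd qz]|i _].
- split; first exact: mem0v.
  have := qZ 0 _ (mem0v (ls_odd L)); have := ls_sqZ 0 (mem0v (ls_odd L)).
  by rewrite !scaler0 expr0n scale0r mul0r => -> ->; rewrite linear0.
- split; first exact: memvD.
  have /eqP := qD _ _ y_odd z_odd; have /eqP := ls_sqD y_odd z_odd.
  rewrite -!addrA -!opprD eq_sym !subr_eq => /eqP -> /eqP ->.
  by rewrite !linearD /= -qy -qz coboundary_br.
- by rewrite memvZ // qZ // ls_sqZ // linearZ /= primitive_sq.
Qed.

End Cocycle.

Lemma H2_of_coord : H2_trivial_eq0 L.
Proof.
move=> c q cq; exists (primitive c q); split=> [x y|x x_odd].
  exact: coboundary_br.
exact: coboundary_sq.
Qed.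


End Coordinates.

(** Without fixed points the indices fall into pairs of equal terms, which cancel in characteristic
    2. *)
Lemma sum_involution (R : nzRingType) (n : nat) (p : 'I_n -> 'I_n)
    (F : 'I_n -> R) : 2%N \in [pchar R] -> involutive p ->
  (forall i, p i != i) -> (forall i, F (p i) = F i) -> \sum_i F i = 0.
Proof.
move=> char2 pK p_neq Fp; rewrite (bigID (fun i : 'I_n => (i < p i)%N)) /=.
rewrite [X in _ + X](reindex_inj (inv_inj pK)) /=.
rewrite [X in _ + X](eq_bigl (fun i : 'I_n => (i < p i)%N)) => [|i].
  by rewrite [X in _ + X](eq_bigr _ (fun i _ => Fp i)) addrr_pchar2.
by have := p_neq i; rewrite pK -(inj_eq val_inj) /=; case: ltngtP.
Qed.

(** * The Gram matrix and the odd generators as explicit matrices *)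

Section OO14.
Variables (K : fieldType) (char2 : 2%N \in [pchar K]).

Local Notation oo := (oo_IPi_1_4 char2).
Local Notation g := (oo1_IPi_1_4 char2).
Local Notation r := (@rshift 1 4).
Local Notation o := (@lshift 1 4 0).
Local Notation ooU := (oo_space char2 (1%:M : 'M_1) (Pi4 K)).

Let addKK (x : K) : x + x = 0. Proof. exact: addrr_pchar2 char2 x. Qed.
Let oppK (x : K) : - x = x. Proof. exact: oppr_pchar2 char2 x. Qed.

(** [Pi4] exchanges the indices 0, 1 with 2, 3, which is addition of 2 modulo 4. *)
Definition partner (i : 'I_4) : 'I_4 := inZp (i + 2).

Lemma partnerK : involutive partner.
Proof. by case=> [[|[|[|[|]]]]] // ?; apply: val_inj. Qed.

Lemma partner_neq i : partner i != i.
Proof. by case: i => [[|[|[|[|]]]]]. Qed.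

Definition gram_perm (a : 'I_(1 + 4)) : 'I_(1 + 4) :=
  match split a with inl i => lshift 4 i | inr j => r (partner j) end.

Lemma gram_perm0 : gram_perm o = o.
Proof. by rewrite /gram_perm (unsplitK (inl _)). Qed.

Lemma gram_perm_rshift i : gram_perm (r i) = r (partner i).
Proof. by rewrite /gram_perm (unsplitK (inr i)). Qed.

Lemma ordP (P : 'I_(1 + 4) -> Prop) : P o -> (forall i, P (r i)) -> forall a, P a.
Proof. by move=> P0 Pr a; case: (split_ordP a) => i ->; rewrite ?(ord1 i). Qed.

Lemma gram_permK : involutive gram_perm.
Proof.
by elim/ordP => [|i]; rewrite ?gram_perm0 // !gram_perm_rshift partnerK.
Qed.

Lemma even_formE (a b : 'I_(1 + 4)) :
  even_form (1%:M : 'M[K]_1) (Pi4 K) a b = (b == gram_perm a)%:R.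
Proof.
rewrite /even_form.
elim/ordP: a => [|i]; elim/ordP: b => [|j]; rewrite ?gram_perm0 ?gram_perm_rshift.
- by rewrite block_mxEul mxE !eqxx.
- by rewrite block_mxEur mxE eq_rlshift.
- by rewrite block_mxEdl mxE eq_lrshift.
rewrite block_mxEdr eq_rshift /Pi4.
case: (@split_ordP 2 2 i) => k ->; case: (@split_ordP 2 2 j) => l ->.
- by rewrite (@block_mxEul _ 2 2 2 2) mxE; case: k l => [[|[]]] // ? [[|[]]].
- by rewrite (@block_mxEur _ 2 2 2 2) mxE; case: k l => [[|[]]] // ? [[|[]]].
- by rewrite (@block_mxEdl _ 2 2 2 2) mxE; case: k l => [[|[]]] // ? [[|[]]].
- by rewrite (@block_mxEdr _ 2 2 2 2) mxE; case: k l => [[|[]]] // ? [[|[]]].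
Qed.

(** Multiplying by the Gram matrix [B] on the left permutes rows, so the condition says that [B X]
    is symmetric. *)
Lemma oo_memP (X : 'M[K]_(1 + 4)) : reflect
  (forall a b, X (gram_perm a) b = X (gram_perm b) a) (X \in ooU).
Proof.
have mulB a b : (even_form (1%:M : 'M[K]_1) (Pi4 K) *m X) a b = X (gram_perm a) b.
  rewrite mxE (bigD1 (gram_perm a)) //= even_formE eqxx mul1r big1 ?addr0 // => k.
  by rewrite even_formE => /negbTE ->; rewrite mul0r.
have mulXB a b : (X^T *m even_form (1%:M : 'M[K]_1) (Pi4 K)) a b = X (gram_perm b) a.
  rewrite mxE (bigD1 (gram_perm b)) //= even_formE gram_permK mxE eqxx mulr1.
  rewrite big1 ?addr0 // => k /negbTE kb.
  by rewrite even_formE -(inj_eq (inv_inj gram_permK)) gram_permK eq_sym kb mulr0.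
apply: (iffP (oo_spaceP char2 _ _ X)) => [XB a b|XB].
  have /matrixP/(_ a b)/eqP := XB.
  by rewrite mxE mulB mulXB mxE addr_eq0 oppK => /eqP.
by apply/matrixP => a b; rewrite mxE mulB mulXB mxE XB addKK.
Qed.

(** The [X] for which [B X] is the symmetric matrix [E_0i + E_i0]. *)
Definition odd_mx (i : 'I_4) : 'M[K]_(1 + 4) :=
  delta_mx o (r i) + delta_mx (r (partner i)) o.

Lemma odd_mxE i a b : odd_mx i a b =
  (a == o)%:R * (b == r i)%:R + (a == r (partner i))%:R * (b == o)%:R.
Proof. by rewrite !mxE -!natrM !mulnb. Qed.

Lemma mul_delta_mxE (c d a b : 'I_(1 + 4)) (Y : 'M[K]_(1 + 4)) :
  (delta_mx c d *m Y) a b = (a == c)%:R * Y d b.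
Proof.
rewrite mxE (bigD1 d) //= mxE eqxx andbT big1 ?addr0 // => k /negbTE kd.
by rewrite mxE kd andbF mul0r.
Qed.

Lemma mul_mx_deltaE (c d a b : 'I_(1 + 4)) (Y : 'M[K]_(1 + 4)) :
  (Y *m delta_mx c d) a b = (b == d)%:R * Y a c.
Proof.
rewrite mxE (bigD1 c) //= mxE eqxx mulrC big1 ?addr0 // => k /negbTE kd.
by rewrite mxE kd mulr0.
Qed.

Lemma mul_odd_mx i (Y : 'M[K]_(1 + 4)) a b : (odd_mx i *m Y) a b =
  (a == o)%:R * Y (r i) b + (a == r (partner i))%:R * Y o b.
Proof. by rewrite mulmxDl mxE !mul_delta_mxE. Qed.

Lemma mul_mx_odd i (Y : 'M[K]_(1 + 4)) a b : (Y *m odd_mx i) a b =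
  (b == r i)%:R * Y a o + (b == o)%:R * Y a (r (partner i)).
Proof. by rewrite mulmxDr mxE !mul_mx_deltaE. Qed.

Lemma odd_mx_oo i : odd_mx i \in ooU.
Proof.
have odd0r k : odd_mx i o (r k) = (k == i)%:R.
  by rewrite odd_mxE eqxx eq_lrshift eq_rshift mul1r mul0r addr0.
have oddr0 k : odd_mx i (r k) o = (k == partner i)%:R.
  by rewrite odd_mxE eqxx eq_rlshift eq_rshift mulr1 mul0r add0r.
have oddrr k l : odd_mx i (r k) (r l) = 0.
  by rewrite odd_mxE !eq_rlshift mul0r mulr0 addr0.
apply/oo_memP; elim/ordP => [|k]; elim/ordP => [|l] //;
  rewrite ?gram_perm0 !gram_perm_rshift ?odd0r ?oddr0 ?oddrr //.
  by rewrite (inj_eq (inv_inj partnerK)).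
by rewrite (inj_eq (inv_inj partnerK)).
Qed.

Lemma odd_mx_odd i : odd_mx i \in gl_odd K 1 4.
Proof.
apply/gl_oddP; apply/matrixP => a b; rewrite /offdiag_part.
elim/ordP: a => [|k]; elim/ordP: b => [|l].
- by rewrite block_mxEul odd_mxE eq_lrshift mxE eq_lrshift mulr0 mul0r addr0.
- by rewrite block_mxEur !mxE.
- by rewrite block_mxEdl !mxE.
- by rewrite block_mxEdr odd_mxE !eq_rlshift mxE mulr0 mul0r addr0.
Qed.

(** * Elements of the derived algebra as matrices *)

Definition mx_of (x : g) : 'M[K]_(1 + 4) :=
  vsval (vsval (x : subvs_of (derived_space oo)) : subvs_of ooU).

Lemma mx_of_inj : injective mx_of.
Proof. by move=> x y /subvs_inj/subvs_inj. Qed.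

Lemma mx_ofP a x y : mx_of (a *: x + y) = a *: mx_of x + mx_of y.
Proof. by rewrite /mx_of !linearP. Qed.

Lemma mx_of_br x y : mx_of \br[x, y] = mx_of x *m mx_of y - mx_of y *m mx_of x.
Proof.
rewrite /mx_of (val_sub_br (derived_sub _)).
exact: (val_sub_br (oo_sub char2 _ _)).
Qed.

Lemma mem_odd x : (x \in ls_odd g) = (mx_of x \in gl_odd K 1 4).
Proof. by rewrite !mem_sub_part. Qed.

Lemma mx_of_sq x : x \in ls_odd g -> mx_of (ls_sq x) = mx_of x *m mx_of x.
Proof.
move=> xo; rewrite /mx_of (val_sub_sq (derived_sub _)) //.
rewrite (val_sub_sq (oo_sub char2 _ _)) //.
by rewrite mem_sub_part; rewrite mem_odd in xo.
Qed.

Lemma mx_of_sym x a b : mx_of x (gram_perm a) b = mx_of x (gram_perm b) a.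
Proof. by have /oo_memP -> := subvsP (vsval x). Qed.

(** The derived space is the least subspace containing brackets and squares, so it is enough that
    the corner entry, a linear functional, kills both. *)
Lemma mx_of00 x : mx_of x o o = 0.
Proof.
pose f (y : oo) : 'M[K]_1 := ulsubmx (vsval (y : subvs_of ooU) : 'M[K]_(1 + 4)).
have f_lin : linear f by move=> a y z; rewrite /f /ulsubmx !linearP.
pose fL := HB.pack_for {linear oo -> 'M[K]_1} f
  (GRing.isLinear.Build _ _ _ _ f f_lin).
have fE (y : oo) : (y \in lker (linfun fL)) =
    ((vsval (y : subvs_of ooU) : 'M[K]_(1 + 4)) o o == 0).
  rewrite memv_ker lfunE /= /f; apply/eqP/eqP => [/matrixP/(_ 0 0)|y0].
    by rewrite !mxE.
  by apply/matrixP => a b; rewrite !mxE !ord1.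
suff /subvP/(_ (vsval (x : subvs_of (derived_space oo)))) :
    (derived_space oo <= lker (linfun fL))%VS.
  by rewrite fE => /(_ (subvsP _))/eqP.
have col0 X k : X \in ooU -> X k o = X o (gram_perm k).
  by move=> /oo_memP Xoo; rewrite -{1}(gram_permK k) Xoo gram_perm0.
apply/derived_spaceP; split=> [y z|y yo]; rewrite fE.
  rewrite (val_sub_br (oo_sub char2 _ _)) !mxE subr_eq0; apply/eqP.
  (* By symmetry the first columns are permuted first rows, so reindexing by [gram_perm] identifies
     the corners of the two products. *)
  rewrite [RHS](reindex_inj (inv_inj gram_permK)); apply: eq_bigr => k _.
  by rewrite !col0 ?subvsP // gram_permK mulrC.
have y00 : (vsval (y : subvs_of ooU) : 'M[K]_(1 + 4)) o o = 0.
  move: yo; rewrite mem_sub_part => /(@gl_oddP K 1 4) ->.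
  by rewrite /offdiag_part block_mxEul mxE.
rewrite (val_sub_sq (oo_sub char2 _ _)) // mxE big_split_ord big_ord1 /=.
(* The remaining sum of [y_0i y_0i'] is invariant under exchanging [i] with its partner [i']. *)
rewrite y00 mul0r add0r (sum_involution char2 partnerK partner_neq) // => i.
by rewrite !col0 ?subvsP // !gram_perm_rshift partnerK mulrC.
Qed.

Definition odd_oo (i : 'I_4) : oo := vsproj ooU (odd_mx i).

Lemma odd_ooK i : vsval (odd_oo i : subvs_of ooU) = odd_mx i.
Proof. by rewrite vsprojK // odd_mx_oo. Qed.

Lemma odd_oo_odd i : odd_oo i \in ls_odd oo.
Proof. by rewrite mem_sub_part odd_ooK; apply: odd_mx_odd. Qed.

(** Each generator is itself a bracket, [e_i = [e_i^2, e_i']] with [i'] the partner of [i]. *)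
Lemma odd_oo_derived i : odd_oo i \in derived_space oo.
Proof.
suff <- : \br[ls_sq (odd_oo i), odd_oo (partner i)] = odd_oo i by apply: derived_br.
apply: subvs_inj; rewrite (val_sub_br (oo_sub char2 _ _)).
rewrite (val_sub_sq (oo_sub char2 _ _)) ?odd_oo_odd // !odd_ooK.
have sqE : odd_mx i *m odd_mx i = delta_mx (r (partner i)) (r i).
  apply/matrixP => a b; rewrite mul_odd_mx !odd_mxE eqxx eq_rlshift eq_rshift.
  rewrite eq_lrshift [i == _]eq_sym (negbTE (partner_neq i)).
  by rewrite !mul0r addr0 mulr0 add0r mul1r addr0 mxE -natrM mulnb.
rewrite [ls_sq _]sqE; apply/matrixP => a b.
rewrite mxE [X in _ + X]mxE oppK mul_mx_odd mul_odd_mx partnerK odd_mxE !mxE.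
rewrite eq_lrshift !eqxx eq_lrshift andbF andbT mulr0 add0r mulr0 addr0.
by rewrite addrC [X in _ + X]mulrC.
Qed.

Definition odd_elt (i : 'I_4) : g := vsproj (derived_space oo) (odd_oo i).

Lemma mx_of_odd_elt i : mx_of (odd_elt i) = odd_mx i.
Proof. by rewrite /mx_of vsprojK ?odd_oo_derived // odd_ooK. Qed.

Lemma odd_elt_odd i : odd_elt i \in ls_odd g.
Proof. by rewrite mem_odd mx_of_odd_elt odd_mx_odd. Qed.

(** * Coordinates on the derived algebra and the conclusion *)

Definition row_coord (x : g) (i : 'I_4) : K := mx_of x o (r i).
(* The lower right block of the symmetric matrix [B X]. *)
Definition block_coord (x : g) (i j : 'I_4) : K := mx_of x (r (partner i)) (r j).

Let mx_of_col0 x i : mx_of x (r i) o = row_coord x (partner i).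
Proof. by rewrite -{1}(partnerK i) -gram_perm_rshift mx_of_sym gram_perm0. Qed.

Lemma oo1_H1_H2_eq0 : H1_adjoint_eq0 g /\ H2_trivial_eq0 g.
Proof.
have vP a x y i : row_coord (a *: x + y) i = a * row_coord x i + row_coord y i.
  by rewrite /row_coord mx_ofP !mxE.
have mP a x y i j :
    block_coord (a *: x + y) i j = a * block_coord x i j + block_coord y i j.
  by rewrite /block_coord mx_ofP !mxE.
have m_sym x i j : block_coord x i j = block_coord x j i.
  by rewrite /block_coord -!gram_perm_rshift mx_of_sym.
(* The corner entry is no coordinate, as it vanishes by [mx_of00]; the first column is determined by
   the first row. *)
have coord_inj x : (forall i, row_coord x i = 0) ->
    (forall i j, block_coord x i j = 0) -> x = 0.
  move=> vx mx; apply: mx_of_inj; apply/matrixP => a b.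
  rewrite [RHS](_ : _ = 0); last by rewrite /mx_of !linear0 mxE.
  elim/ordP: a => [|i]; elim/ordP: b => [|j]; rewrite ?mx_of00 ?mx_of_col0 ?vx //.
    exact: vx.
  by rewrite -(partnerK i); apply: mx.
have v_e i j : row_coord (odd_elt i) j = (j == i)%:R.
  rewrite /row_coord mx_of_odd_elt odd_mxE eqxx eq_lrshift eq_rshift.
  by rewrite mul1r mul0r addr0.
have m_e i a b : block_coord (odd_elt i) a b = 0.
  by rewrite /block_coord mx_of_odd_elt odd_mxE !eq_rlshift mul0r mulr0 addr0.
have v_sq i j : row_coord (ls_sq (odd_elt i)) j = 0.
  rewrite /row_coord mx_of_sq ?odd_elt_odd // mx_of_odd_elt mul_odd_mx.
  by rewrite !odd_mxE !eq_lrshift !eq_rlshift !(mulr0, mul0r, addr0).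
have m_sq i a b : block_coord (ls_sq (odd_elt i)) a b = (a == i)%:R * (b == i)%:R.
  rewrite /block_coord mx_of_sq ?odd_elt_odd // mx_of_odd_elt mul_odd_mx.
  rewrite !odd_mxE !eq_rlshift eq_lrshift eqxx !eq_rshift.
  by rewrite (inj_eq (inv_inj partnerK)) !(mul0r, mul1r, mulr0, add0r, addr0).
have v_br i y b : row_coord \br[odd_elt i, y] b = block_coord y (partner i) b.
  rewrite /row_coord /block_coord mx_of_br mxE [X in _ + X]mxE oppK mx_of_odd_elt.
  rewrite mul_odd_mx mul_mx_odd mx_of00 eqxx eq_lrshift eq_rlshift partnerK.
  by rewrite !(mul0r, mul1r, mulr0, add0r, addr0).
have m_br i y a b : block_coord \br[odd_elt i, y] a b =
    (a == i)%:R * row_coord y b + (b == i)%:R * row_coord y a.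
  rewrite /row_coord /block_coord mx_of_br mxE [X in _ + X]mxE oppK mx_of_odd_elt.
  rewrite mul_odd_mx mul_mx_odd !eq_rlshift !eq_rshift mx_of_col0 partnerK.
  by rewrite (inj_eq (inv_inj partnerK)) /row_coord !(mul0r, add0r, addr0).
have m_odd x i j : x \in ls_odd g -> block_coord x i j = 0.
  rewrite mem_odd /block_coord => /(@gl_oddP K 1 4) ->.
  by rewrite /offdiag_part block_mxEdr mxE.
split.
  exact: (H1_of_coord partnerK partner_neq odd_elt_odd vP mP m_sym coord_inj
    v_e m_e v_sq m_sq v_br m_br).
exact: (H2_of_coord partnerK partner_neq odd_elt_odd vP mP m_sym coord_inj
  v_e m_e v_sq m_sq v_br m_br m_odd).
Qed.

End OO14.

Theorem lemma3p2 (K : closedFieldType) (char2 : 2%N \in [pchar K]) :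
  H1_adjoint_eq0 (oo1_IPi_1_4 char2) /\ H2_trivial_eq0 (oo1_IPi_1_4 char2).
Proof. exact: oo1_H1_H2_eq0. Qed.
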